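(* Let $n,q\in\{1,2,\ldots\}$, let $\|\cdot\|$ be a norm on $\mathbb{R}^q$, let $C\subseteq\mathbb{R}^q$ be a polyhedral closed convex cone that is solid, pointed and nontrivial, let $X\subseteq\mathbb{R}^n$ be convex, let $\Gamma\colon X\to\mathbb{R}^q$ be $C$-convex and continuous, let $\mathcal{X}\subseteq X$ be a compact convex set with nonempty interior, and let $\epsilon>0$. Then Algorithm 2 (described in the context) terminates after a finite number of iterations.
   Context: A cone $C$ is solid if its interior is nonempty, pointed if it contains no line, nontrivial if $\{0\}\subsetneq C\subsetneq\mathbb{R}^q$. For $y_1,y_2\in\mathbb{R}^q$, $y_1\leq_C y_2$ means $y_2-y_1\in C$. $\Gamma$ is $C$-convex if $\Gamma(\lambda x_1+(1-\lambda)x_2)\leq_C\lambda\Gamma(x_1)+(1-\lambda)\Gamma(x_2)$ for all $x_1,x_2\in X$, $\lambda\in[0,1]$. The dual cone is $C^+=\{w\in\mathbb{R}^q\mid w^{\mathsf T}y\ge 0\ \forall y\in C\}$; it is polyhedral, and $w^1,\ldots,w^J$ denote fixed nonzero generating vectors of it, so $C^+=\operatorname{conv}\operatorname{cone}\{w^1,\ldots,w^J\}$. $\|\cdot\|_*$ is the dual norm. The upper image is $\mathcal{P}=\operatorname{cl}(\Gamma(\mathcal{X})+C)$. $\delta^H$ is the Hausdorff distance induced by $\|\cdot\|$; $a^+=\max\{a,0\}$ for $a\in\mathbb{R}$. Scalarizations: for $w\in C^+\setminus\{0\}$, $(\mathrm{WS}(w))$ is: minimize $w^{\mathsf T}\Gamma(x)$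 subject to $x\in\mathcal{X}$. For $v\in\mathbb{R}^q$, $(\mathrm{P}(v))$ is: minimize $\|z\|$ subject to $\Gamma(x)-z-v\le_C 0$, $x\in\mathcal{X}$, $z\in\mathbb{R}^q$; and $(\mathrm{D}(v))$ is: maximize $\inf_{x\in\mathcal{X}}w^{\mathsf T}\Gamma(x)-w^{\mathsf T}v$ subject to $\|w\|_*\le1$, $w\in C^+$. For each $v$, $(x^v,z^v)$ and $w^v$ denote arbitrary optimal solutions of $(\mathrm{P}(v))$ and $(\mathrm{D}(v))$. Algorithm 2. Initialization: compute an optimal solution $x^j$ of $(\mathrm{WS}(w^j))$ for each $j$; set $k=0$, $\bar{\mathcal{X}}_0=\{x^1,\ldots,x^J\}$, $\mathcal{V}^{\text{known}}=\emptyset$, $\mathcal{P}^{\text{out}}_0=\bigcap_{j=1}^J\{y\mid (w^j)^{\mathsf T}y\ge(w^j)^{\mathsf T}\Gamma(x^j)\}$; let $\mathcal{V}_0$ be the set of vertices of $\mathcal{P}^{\text{out}}_0$ and set $\bar{\mathcal{P}}^{\text{out}}_0=\mathcal{P}^{\text{out}}_0$. For each $v\in\mathcal{V}_0$: compute $(x^v,z^v)$, $w^v$; add $v$ to $\mathcal{V}^{\text{known}}$; if $\|z^v\|>\epsilon$, replace $\bar{\mathcal{P}}^{\text{out}}_0$ by $\bar{\mathcal{P}}^{\text{out}}_0\cap\{y\mid (w^v)^{\mathsf T}y\ge(w^v)^{\mathsf T}\Gamma(x^v)\}$; otherwise replace $\bar{\mathcal{X}}_0$ by $\bar{\mathcal{X}}_0\cup\{x^v\}$.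 Put $\bar w=\sum_{j=1}^Jw^j/\|\sum_{j=1}^Jw^j\|_*$, fix $\beta\in\mathbb{R}$ with $\beta\ge\sup_{x\in\mathcal{X}}\bar w^{\mathsf T}\Gamma(x)$, fix $\alpha\in\mathbb{R}$ with $\alpha>\max_{v\in\mathcal{V}_0}(\bar w^{\mathsf T}v-\beta)^++\delta^H(\mathcal{P}^{\text{out}}_0,\mathcal{P})$, and set $S=\{y\in\mathbb{R}^q\mid\bar w^{\mathsf T}y\le\beta+\alpha\}$. Main loop (iteration $k$): compute the set $\bar{\mathcal{V}}_k$ of vertices of $\bar{\mathcal{P}}^{\text{out}}_k\cap S$. Go through $v\in\bar{\mathcal{V}}_k$ in an arbitrary order, skipping those in $\mathcal{V}^{\text{known}}$. For each $v\notin\mathcal{V}^{\text{known}}$: compute $(x^v,z^v)$ and $w^v$, and add $v$ to $\mathcal{V}^{\text{known}}$. If $\|z^v\|>\epsilon$, set $\bar{\mathcal{P}}^{\text{out}}_{k+1}=\bar{\mathcal{P}}^{\text{out}}_k\cap\{y\mid(w^v)^{\mathsf T}y\ge(w^v)^{\mathsf T}\Gamma(x^v)\}$, $\bar{\mathcal{X}}_{k+1}=\bar{\mathcal{X}}_k$, increase $k$ by one, and immediately restart the main loop. Otherwise replace $\bar{\mathcal{X}}_k$ by $\bar{\mathcal{X}}_k\cup\{x^v\}$ and continue with the next vertex. If all vertices of $\bar{\mathcal{V}}_k$ are gone through without a restart, terminate and return $\bar{\mathcal{X}}_k$ and $\bar{\mathcal{P}}^{\text{out}}_k$. *)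

(* Defs.v *)
From HB Require Import structures.
From mathcomp Require Import all_boot all_order all_algebra.
From mathcomp Require Import all_classical all_reals all_analysis.
Set Implicit Arguments.
Unset Strict Implicit.
Unset Printing Implicit Defensive.
Import Order.TTheory GRing.Theory Num.Theory numFieldNormedType.Exports.
Local Open Scope classical_set_scope.
Local Open Scope ring_scope.

(* R^n is 'cV[R]_n with its usual (product)
   topology; the problem's norm is a separate function on it, because the
   canonical norm of matrices is the sup-norm. *)

Record is_norm (R : realType) (V : lmodType R) (N : V -> R) : Prop := IsNorm {
  norm_triangle : forall x y, N (x + y) <= N x + N y ;
  norm_homog : forall a x, N (a *: x) = `|a| * N x ;
  norm_definite : forall x, N x = 0 -> x = 0 }.

Definition dot (R : realType) (q : nat) (w y : 'cV[R]_q) : R :=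
  (w^T *m y) 0 0.

Definition dual_norm (R : realType) (q : nat) (N : 'cV[R]_q -> R)
    (w : 'cV[R]_q) : R :=
  sup [set dot w y | y in [set y | N y <= 1]].

(* The suprema and infima are taken in the extended reals, so the distance of
   two sets that stay unboundedly far apart is +oo. *)
Definition hausdorff_dist (R : realType) (q : nat) (N : 'cV[R]_q -> R)
    (A B : set 'cV[R]_q) : \bar R :=
  maxe (ereal_sup [set ereal_inf [set (N (a - b))%:E | b in B] | a in A])
       (ereal_sup [set ereal_inf [set (N (a - b))%:E | a in A] | b in B]).

Section cones.
Context {R : realType} {q : nat}.
Implicit Types C : set 'cV[R]_q.

Definition polyhedron C : Prop :=
  exists (m : nat) (A : 'M[R]_(m, q)) (b : 'cV[R]_m),
    C = [set y | forall i, b i 0 <= (A *m y) i 0].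

Definition cone C : Prop := forall t y, 0 <= t -> C y -> C (t *: y).

Definition solid C : Prop := interior C !=set0.

Definition pointed_cone C : Prop :=
  ~ exists a d : 'cV[R]_q, d != 0 /\ forall t : R, C (a + t *: d).

Definition nontrivial_cone C : Prop := [set 0] `<` C /\ C `<` setT.

Definition le_cone C (y1 y2 : 'cV[R]_q) : Prop := C (y2 - y1).

Definition dual_cone C : set 'cV[R]_q :=
  [set w | forall y, C y -> 0 <= dot w y].

Definition conv_cone (J : nat) (W : 'I_J -> 'cV[R]_q) : set 'cV[R]_q :=
  [set y | exists l : 'I_J -> R,
     (forall j, 0 <= l j) /\ y = \sum_(j < J) l j *: W j].

Definition halfspace (w a : 'cV[R]_q) : set 'cV[R]_q :=
  [set y | dot w a <= dot w y].

(* The vertices of a polyhedron are its extreme points. *)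
Definition vertices (P : set 'cV[R]_q) : set 'cV[R]_q :=
  [set v | P v /\ forall a b (t : R), P a -> P b -> 0 < t < 1 ->
     v = t *: a + (1 - t) *: b -> a = b].

End cones.

Definition cone_convex (R : realType) (n q : nat) (C : set 'cV[R]_q)
    (X : set 'cV[R]_n) (G : 'cV[R]_n -> 'cV[R]_q) : Prop :=
  forall x1 x2 (t : R), X x1 -> X x2 -> 0 <= t <= 1 ->
    le_cone C (G (t *: x1 + (1 - t) *: x2)) (t *: G x1 + (1 - t) *: G x2).

Section problem.
Context {R : realType} {n q : nat}.
Variables (N : 'cV[R]_q -> R) (C : set 'cV[R]_q).
(* F is the feasible set; G is meaningful only on the domain X, F `<=` X. *)
Variables (F : set 'cV[R]_n) (G : 'cV[R]_n -> 'cV[R]_q).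

Definition upper_image : set 'cV[R]_q :=
  closure [set G x + c | x in F & c in C].

Definition WS_optimal (w : 'cV[R]_q) (x : 'cV[R]_n) : Prop :=
  F x /\ forall x', F x' -> dot w (G x) <= dot w (G x').

Definition P_feasible (v : 'cV[R]_q) (x : 'cV[R]_n) (z : 'cV[R]_q) : Prop :=
  le_cone C (G x - z - v) 0 /\ F x.

Definition P_optimal (v : 'cV[R]_q) (x : 'cV[R]_n) (z : 'cV[R]_q) : Prop :=
  P_feasible v x z /\ forall x' z', P_feasible v x' z' -> N z <= N z'.

Definition D_feasible (w : 'cV[R]_q) : Prop :=
  dual_norm N w <= 1 /\ dual_cone C w.

Definition D_objective (v w : 'cV[R]_q) : \bar R :=
  (ereal_inf [set (dot w (G x))%:E | x in F] - (dot w v)%:E)%E.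

Definition D_optimal (v w : 'cV[R]_q) : Prop :=
  D_feasible w /\
  forall w', D_feasible w' -> (D_objective v w' <= D_objective v w)%E.

End problem.

Section algorithm.
Context {R : realType} {n q : nat}.
Variables (N : 'cV[R]_q -> R) (C : set 'cV[R]_q).
Variables (F : set 'cV[R]_n) (G : 'cV[R]_n -> 'cV[R]_q).
Variables (eps : R) (S : set 'cV[R]_q).

(* The fields are: T, the vertices of the current vertex set that are still to
   be gone through; K, the known vertices; Xs, the current set of solutions;
   P, the current outer approximation; k, the iteration counter. *)
Inductive state : Type :=
| Init (T K : set 'cV[R]_q) (Xs : set 'cV[R]_n) (P : set 'cV[R]_q)
| Main (k : nat) (T K : set 'cV[R]_q) (Xs : set 'cV[R]_n) (P : set 'cV[R]_q)
| Done (Xs : set 'cV[R]_n) (P : set 'cV[R]_q).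

(* Nondeterminism: any vertex of T may come next, and the optimal solutions
   computed for it are arbitrary. *)
Inductive step : state -> state -> Prop :=
| step_init_cut T K Xs P v x z w :
    T v -> P_optimal N C F G v x z -> D_optimal N C F G v w -> eps < N z ->
    step (Init T K Xs P)
         (Init (T `\ v) (v |` K) Xs (P `&` halfspace w (G x)))
| step_init_add T K Xs P v x z w :
    T v -> P_optimal N C F G v x z -> D_optimal N C F G v w -> N z <= eps ->
    step (Init T K Xs P) (Init (T `\ v) (v |` K) (x |` Xs) P)
| step_init_end K Xs P :
    step (Init set0 K Xs P) (Main 0 (vertices (P `&` S)) K Xs P)
| step_main_skip k T K Xs P v :
    T v -> K v ->
    step (Main k T K Xs P) (Main k (T `\ v) K Xs P)
| step_main_cut k T K Xs P v x z w :
    T v -> ~ K v ->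
    P_optimal N C F G v x z -> D_optimal N C F G v w -> eps < N z ->
    step (Main k T K Xs P)
         (Main k.+1 (vertices (P `&` halfspace w (G x) `&` S)) (v |` K) Xs
            (P `&` halfspace w (G x)))
| step_main_add k T K Xs P v x z w :
    T v -> ~ K v ->
    P_optimal N C F G v x z -> D_optimal N C F G v w -> N z <= eps ->
    step (Main k T K Xs P) (Main k (T `\ v) (v |` K) (x |` Xs) P)
| step_main_end k K Xs P :
    step (Main k set0 K Xs P) (Done Xs P).

(* Every execution from the given state is finite and ends in a Done state:
   the inductive definition excludes infinite executions, and the first
   premise of terminates_step excludes executions that get stuck. *)
Inductive terminates : state -> Prop :=
| terminates_done Xs P : terminates (Done Xs P)
| terminates_step s s1 :
    step s s1 -> (forall s', step s s' -> terminates s') -> terminates s.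

End algorithm.

Section initialization.
Context {R : realType} {n q J : nat}.
Variables (N : 'cV[R]_q -> R) (G : 'cV[R]_n -> 'cV[R]_q).
Variables (W : 'I_J -> 'cV[R]_q) (x0 : 'I_J -> 'cV[R]_n).

Definition P0_out : set 'cV[R]_q :=
  \bigcap_(j in [set: 'I_J]) halfspace (W j) (G (x0 j)).

Definition wbar : 'cV[R]_q :=
  (dual_norm N (\sum_(j < J) W j))^-1 *: \sum_(j < J) W j.

Definition bounding_halfspace (alpha beta : R) : set 'cV[R]_q :=
  [set y | dot wbar y <= beta + alpha].

Definition initial_state : state :=
  Init (vertices P0_out) set0 (range x0) P0_out.

End initialization.

(* Main.v *)
Require Import Defs.
From HB Require Import structures.
From mathcomp Require Import all_boot all_order all_algebra.
From mathcomp Require Import all_classical all_reals all_analysis.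
From mathcomp Require Import lra ring.
Import Order.TTheory GRing.Theory Num.Theory numFieldNormedType.Exports.
Local Open Scope classical_set_scope.
Local Open Scope ring_scope.

(** Only finitely many cuts can be made, because the points at which cuts are
    made stay away from each other and lie in a bounded set.

    Let a cut be made at [v], with primal solution [(x, z)], [eps < N z], and
    dual solution [w]. The optimal value of the primal problem is the distance
    from [v] to the convex closed set [G F + C]; as it exceeds [eps], a
    hyperplane separates this set from the ball of radius [eps] around [v], so
    the dual problem has a feasible point of value at least [eps]. Hence the
    optimal [w] satisfies [eps <= dot w (G x) - dot w v] ([cut_depth]). As the
    dual norm of [w] is at most 1, every point [y] of the half-space that is
    kept, and so every vertex considered later, satisfies [eps <= N (y - v)]
    ([cut_far]).

    All the points at which the main loop makes cuts lie in the initial outer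
    approximation intersected with the bounding half-space. This set is bounded
    ([outer_approximation_bounded]): each generator of the dual cone is bounded
    below on the outer approximation, their sum is bounded above on the bounding
    half-space, and the generators span the space because the cone is pointed.
    A bounded set contains only boundedly many pairwise [eps]-separated points
    ([separated_size_bounded]).

    Between two cuts, each step removes a vertex from the set of those still to
    be gone through, which is finite because a vertex of a polyhedron is
    determined by the constraints that are tight at it ([finite_vertices]).
    Finally no execution gets stuck, since compactness gives solutions of both
    scalarized problems at every point ([P_optimal_exists],
    [D_optimal_exists]). *)

Set Implicit Arguments.
Unset Strict Implicit.
Unset Printing Implicit Defensive.

(** * Topology of matrix spaces *)

Section matrix_topology.
Context {R : realType}.

Lemma entry_le_norm m n (M : 'M[R]_(m, n)) i j : `|M i j| <= `|M|.
Proof.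
rewrite [leRHS]/Num.norm /= mx_normrE.
by apply/bigmax_geP; right; exists (i, j).
Qed.

Lemma norm_le_entries m n (M : 'M[R]_(m, n)) c :
  0 <= c -> (forall i j, `|M i j| <= c) -> `|M| <= c.
Proof.
move=> c0 Mc; rewrite [leLHS]/Num.norm /= mx_normrE.
by apply/bigmax_leP; split => // -[i j] _ /=.
Qed.

Lemma lipschitz_continuous (V W : normedModType R) (f : V -> W) k :
  (forall x y, `|f x - f y| <= k * `|x - y|) -> continuous f.
Proof.
move=> fk x; apply/cvgrPdist_lt => e e0; near=> y.
have k0 : 0 < `|k| + 1 by rewrite ltr_wpDl.
apply: (le_lt_trans (fk x y)).
apply: (@le_lt_trans _ _ ((`|k| + 1) * `|x - y|)).
  by rewrite ler_wpM2r// (le_trans (ler_norm k))// lerDl.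
rewrite mulrC -ltr_pdivlMr//.
by near: y; apply: cvgr_dist_lt; rewrite ?divr_gt0//; exact: cvg_id.
Unshelve. all: by end_near. Qed.

Lemma trmx_continuous m n : continuous (@trmx R m n).
Proof.
apply: (@lipschitz_continuous _ _ _ 1) => x y.
rewrite mul1r; apply: norm_le_entries => // i j.
by rewrite -linearB/= mxE entry_le_norm.
Qed.

(** The Heine-Borel property of row vectors, carried over by transposition. *)
Lemma cV_bounded_closed_compact q (A : set 'cV[R]_q) L :
  (forall y, A y -> forall i, `|y i 0| <= L) -> closed A -> compact A.
Proof.
move=> AL clA.
have -> : A = trmx @` (trmx @^-1` A).
  apply/seteqP; split=> [y Ay|_ [z /= Az <-]//].
  by exists (y^T); rewrite /= trmxK.
apply: continuous_compact; first exact/continuous_subspaceT/trmx_continuous.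
apply: bounded_closed_compact.
  exists `|L|; split; first exact: num_real.
  move=> M LM z /= Az; apply: norm_le_entries => [|i j].
    by rewrite (le_trans _ (ltW LM)).
  have := AL _ Az j; rewrite mxE (ord1 i) => /le_trans; apply.
  by rewrite (le_trans (ler_norm _))// ltW.
by apply: preimage_closed => // x _; exact: trmx_continuous.
Qed.

(** If [y] is not in the sum, then [y - b] avoids the closed set [A] for every
    [b] in [B]; by compactness of [B] a single neighbourhood of [y] works for
    all [b] at once. *)
Lemma closedD_compact (V : normedModType R) (A B : set V) :
  closed A -> compact B -> closed [set a + b | a in A & b in B].
Proof.
move=> clA cB; rewrite -[X in closed X]setCK; apply: open_closedC.
rewrite openE => y nABy; rewrite /interior.
have : \forall y' \near y, B `<=` (fun b => ~ A (y' - b)).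
  move/compact_near_coveringP: cB; apply => b Bb.
  have nA : ~ A (y - b).
    by move=> Ayb; apply: nABy; exists (y - b) => //; exists b; rewrite ?subrK.
  have : continuous (fun p : V * V => p.2 - p.1).
    by move=> p; apply: cvgB; [exact: cvg_snd|exact: cvg_fst].
  move=> /(_ (b, y)) /(_ (~` A)) /=; apply.
  by apply: open_nbhs_nbhs; split => //; exact: closed_openC.
apply: filterS => y' By' [a Aa [b Bb aby]].
by apply: (By' b Bb); rewrite -aby addrK.
Qed.

End matrix_topology.

(** * The dot product and separation *)

Section dot_product.
Context {R : realType} {q : nat}.
Implicit Types (w y z : 'cV[R]_q) (A : set 'cV[R]_q).

Lemma dotE w y : dot w y = \sum_i w i 0 * y i 0.
Proof. by rewrite /dot mxE; apply: eq_bigr => i _; rewrite mxE. Qed.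

Lemma dotC w y : dot w y = dot y w.
Proof. by rewrite !dotE; apply: eq_bigr => i _; rewrite mulrC. Qed.

Lemma dotDr w y z : dot w (y + z) = dot w y + dot w z.
Proof. by rewrite /dot mulmxDr mxE. Qed.

Lemma dotZr a w y : dot w (a *: y) = a * dot w y.
Proof. by rewrite /dot -scalemxAr mxE. Qed.

Lemma dotNr w y : dot w (- y) = - dot w y.
Proof. by rewrite -scaleN1r dotZr mulN1r. Qed.

Lemma dotBr w y z : dot w (y - z) = dot w y - dot w z.
Proof. by rewrite dotDr dotNr. Qed.

Lemma dotZl a w y : dot (a *: w) y = a * dot w y.
Proof. by rewrite dotC dotZr dotC. Qed.

Lemma dotDl w y z : dot (w + y) z = dot w z + dot y z.
Proof. by rewrite dotC dotDr !(dotC z). Qed.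

Lemma dotBl w y z : dot (w - y) z = dot w z - dot y z.
Proof. by rewrite dotC dotBr !(dotC z). Qed.

Lemma dotNl w y : dot (- w) y = - dot w y.
Proof. by rewrite dotC dotNr dotC. Qed.

Lemma dot0r w : dot w 0 = 0.
Proof. by rewrite -(scale0r 0) dotZr mul0r. Qed.

Lemma dot0l w : dot 0 w = 0.
Proof. by rewrite dotC dot0r. Qed.

Lemma dot_suml (I : finType) (w : I -> 'cV[R]_q) y :
  dot (\sum_i w i) y = \sum_i dot (w i) y.
Proof. by rewrite /dot linear_sum/= mulmx_suml summxE. Qed.

Lemma dot_delta i y : dot (delta_mx i 0) y = y i 0.
Proof.
rewrite dotE (bigD1 i)//= big1 ?addr0; last first.
  by move=> k /negbTE ki; rewrite mxE ki mul0r.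
by rewrite mxE !eqxx mul1r.
Qed.

Lemma sqr_entry_le_dot y i : (y i 0) ^+ 2 <= dot y y.
Proof.
rewrite dotE (bigD1 i)//= -expr2 lerDl.
by apply: sumr_ge0 => k _; rewrite -expr2 sqr_ge0.
Qed.

Lemma dot_gt0 y : y != 0 -> 0 < dot y y.
Proof.
apply: contra_neqT; rewrite -leNgt => yy; apply/colP => i; rewrite mxE.
apply/eqP; rewrite -sqrf_eq0 eq_le sqr_ge0 andbT.
exact: le_trans (sqr_entry_le_dot y i) yy.
Qed.

Lemma abs_dot_le w y : `|dot w y| <= q%:R * `|w| * `|y|.
Proof.
rewrite dotE (le_trans (ler_norm_sum _ _ _))//.
rewrite -mulrA -[X in X%:R * _]card_ord mulr_natl -sumr_const.
by apply: ler_sum => i _; rewrite normrM ler_pM// entry_le_norm.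
Qed.

Lemma dot_continuous w : continuous (dot w).
Proof.
apply: (@lipschitz_continuous _ _ _ _ (q%:R * `|w|)) => y z.
by rewrite -dotBr abs_dot_le.
Qed.

Lemma closed_halfspace w c : closed [set y | c <= dot w y].
Proof.
apply: (@preimage_closed _ _ (dot w) [set x | c <= x]).
  by move=> x _; exact: dot_continuous.
exact: closed_ge.
Qed.

Lemma sqr_dot_continuous : continuous (fun y => dot y y).
Proof.
have -> : (fun y => dot y y) = (fun z => \sum_i z i 0 * z i 0).
  by apply/funext => z; rewrite dotE.
apply: continuous_big => [|i _ y]; first exact: add_continuous.
by apply: (@cvgM _ _ (nbhs y)); exact: (@coord_continuous _ _ _ i 0 y).
Qed.

(** Coercivity confines the minimization to a compact sublevel set. *)
Lemma coercive_attains_min (f : 'cV[R]_q -> R) A :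
  continuous f -> (forall M, exists L, forall y, f y <= M ->
    forall i, `|y i 0| <= L) ->
  closed A -> A !=set0 -> exists2 y, A y & forall z, A z -> f y <= f z.
Proof.
move=> fc fco clA [a Aa].
have [L fL] := fco (f a).
pose B := A `&` [set y | f y <= f a].
have clB : closed B.
  apply: closedI => //; apply: (@preimage_closed _ _ f [set x | x <= f a]).
    by move=> x _; exact: fc.
  exact: closed_le.
have cB : compact B.
  by apply: cV_bounded_closed_compact clB => y [_ /fL]; exact.
have [y yB miny] : exists2 c, c \in B & forall t, t \in B -> f c <= f t.
  apply: compact_EVT_min => //; first by exists a; split=> /=.
  exact: continuous_subspaceT.
move: yB; rewrite inE => -[Ay fya]; exists y => // z Az.
have [fz|/ltW fz] := leP (f z) (f a); last exact: le_trans fya fz.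
by apply: miny; rewrite inE; split.
Qed.

(** Convexity, with a real weight in place of an element of the bundled unit
    interval. *)
Definition segment_closed A := forall a b (t : R), A a -> A b -> 0 <= t <= 1 ->
  A (t *: a + (1 - t) *: b).

Lemma convex_setP A : convex_set A -> segment_closed A.
Proof.
move=> cA a b t Aa Ab /andP[t0 t1].
have /= := cA a b (Itv01 t0 t1); rewrite !inE => /(_ Aa Ab).
by [].
Qed.

(** The normal of the separating hyperplane is the point [w] of [A] nearest to
    the origin: moving from [w] towards any [y] in [A] cannot decrease the
    Euclidean length, which forces [dot w (y - w) >= 0]. *)
Lemma convex_closed_sep0 A :
  closed A -> segment_closed A -> A !=set0 -> ~ A 0 ->
  exists2 w, w != 0 & forall y, A y -> 0 < dot w y.
Proof.
move=> clA cA A0 nA0.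
have [||||w Aw minw] := @coercive_attains_min (fun y => dot y y) A => //.
- exact: sqr_dot_continuous.
- move=> M; exists (Num.sqrt M) => y yM i.
  rewrite -sqrtr_sqr ler_wsqrtr// (le_trans _ yM)//.
  exact: sqr_entry_le_dot.
have wn0 : w != 0 by apply/eqP => w0; apply: nA0; rewrite -w0.
exists w => // y Ay; apply: lt_le_trans (dot_gt0 wn0) _.
rewrite -subr_ge0 -dotBr; have : y = w + (y - w) by rewrite addrC subrK.
move: (y - w) => d yE.
have dd t : 0 < t <= 1 -> - (t * dot d d) <= 2 * dot w d.
  move=> /andP[t0 t1].
  have := minw _ (cA _ _ t Ay Aw _); rewrite (ltW t0) t1 => /(_ isT).
  have -> : t *: y + (1 - t) *: w = w + t *: d.
    by rewrite yE; apply/colP => i; rewrite !mxE; ring.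
  rewrite !(dotDl, dotDr, dotZl, dotZr) (dotC d w) => h.
  rewrite -(ler_pM2l t0); lra.
have [->//|dn0] := eqVneq d 0; first by rewrite dot0r.
rewrite leNgt; apply/negP => wd.
have dd0 := dot_gt0 dn0.
pose t := Num.min 1 (- dot w d / dot d d).
have t0 : 0 < t by rewrite lt_min ltr01 divr_gt0// oppr_gt0.
have := dd t; rewrite t0 ge_min lexx => /(_ isT).
have : t * dot d d <= - dot w d by rewrite -ler_pdivlMr// ge_min lexx orbT.
lra.
Qed.

End dot_product.

(** * Norms and dual norms *)

Section norms.
Context {R : realType} {q : nat} (N : 'cV[R]_q -> R) (N_norm : is_norm N).
Implicit Types (w y z : 'cV[R]_q).

Let ND := norm_triangle N_norm.
Let NZ := norm_homog N_norm.

Lemma is_norm0 : N 0 = 0.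
Proof. by rewrite -(scale0r 0) NZ normr0 mul0r. Qed.

Lemma is_normN y : N (- y) = N y.
Proof. by rewrite -scaleN1r NZ normrN1 mul1r. Qed.

Lemma is_norm_ge0 y : 0 <= N y.
Proof. by have := ND y (- y); rewrite subrr is_norm0 is_normN; lra. Qed.

Lemma is_norm_gt0 y : y != 0 -> 0 < N y.
Proof.
move=> y0; rewrite lt_neqAle is_norm_ge0 andbT eq_sym.
by apply: contraNneq y0 => /(norm_definite N_norm) ->.
Qed.

Lemma is_norm_sum (I : finType) (f : I -> 'cV[R]_q) :
  N (\sum_i f i) <= \sum_i N (f i).
Proof.
elim/big_ind2 : _ => //; first by rewrite is_norm0.
by move=> a a' b b' h h'; exact: le_trans (ND _ _) (lerD h h').
Qed.

Lemma is_norm_le_mx_norm : exists k, forall y, N y <= k * `|y|.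
Proof.
exists (\sum_(i < q) N (delta_mx i 0)) => y.
have -> : y = \sum_i y i 0 *: delta_mx i 0.
  by rewrite [LHS]matrix_sum_delta; apply: eq_bigr => i _; rewrite big_ord1.
apply: (le_trans (is_norm_sum _)); rewrite mulr_suml; apply: ler_sum => i _.
rewrite NZ mulrC ler_wpM2l ?is_norm_ge0//.
rewrite -[X in _ <= `|X|](_ : y = _) ?entry_le_norm//.
by rewrite [LHS]matrix_sum_delta; apply: eq_bigr => k _; rewrite big_ord1.
Qed.

Lemma is_norm_continuous : continuous N.
Proof.
have [k Nk] := is_norm_le_mx_norm.
apply: (@lipschitz_continuous _ _ _ _ k) => x y; apply: le_trans (Nk _).
have := ND (y - x) x; have := ND (x - y) y.
rewrite !subrK -(opprB x y) is_normN => h1 h2.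
by rewrite ler_norml; apply/andP; split; lra.
Qed.

(** All norms of a finite-dimensional space are equivalent: the unit sphere of
    the sup norm is compact, so the continuous positive function [N] is bounded
    away from 0 on it. *)
Lemma mx_norm_le_is_norm : exists2 c, 0 < c & forall y, c * `|y| <= N y.
Proof.
pose S := [set y : 'cV[R]_q | `|y| = 1].
have unitS y : y != 0 -> S (`|y|^-1 *: y).
  by move=> y0; rewrite /S/= normrZ normfV normr_id mulVf// normr_eq0.
have [[y0 Sy0]|S0] := pselect (S !=set0); last first.
  exists 1 => // y; have [->|/unitS Sy] := eqVneq y 0.
    by rewrite normr0 mulr0 is_norm0.
  by exfalso; apply: S0; eexists; exact: Sy.
have clS : closed S.
  apply: (@preimage_closed _ _ (fun y : 'cV[R]_q => `|y|) [set 1]).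
    by move=> x _; exact: norm_continuous.
  by apply: compact_closed; [exact: Rhausdorff|exact: compact_set1].
have cS : compact S.
  apply: (@cV_bounded_closed_compact _ _ _ 1) => // y <- i.
  exact: entry_le_norm.
have [|||m mS minm] := @compact_EVT_min _ _ N S.
- by exists y0.
- by [].
- exact/continuous_subspaceT/is_norm_continuous.
exists (N m).
  apply: is_norm_gt0; apply/eqP => m0; move: mS; rewrite inE m0 /S/= normr0.
  by move/eqP; rewrite eq_sym oner_eq0.
move=> y; have [->|y1] := eqVneq y 0; first by rewrite normr0 mulr0 is_norm0.
have := minm (`|y|^-1 *: y); rewrite inE => /(_ (unitS _ y1)).
by rewrite NZ normfV normr_id mulrC ler_pdivlMr// normr_gt0.
Qed.

Lemma is_norm_coercive M :
  exists L, forall y, N y <= M -> forall i, `|y i 0| <= L.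
Proof.
have [c c0 Nc] := mx_norm_le_is_norm; exists (M / c) => y NyM i.
rewrite (le_trans (entry_le_norm _ _ _))// ler_pdivlMr// mulrC.
exact: le_trans (Nc y) NyM.
Qed.

Lemma is_norm_ball_compact r : compact [set y | N y <= r].
Proof.
have [L NL] := is_norm_coercive r.
apply: (@cV_bounded_closed_compact _ _ _ L) => //.
apply: (@preimage_closed _ _ N [set x | x <= r]); last exact: closed_le.
by move=> x _; exact: is_norm_continuous.
Qed.

Lemma dot_le_dual_norm_ball w y : N y <= 1 -> dot w y <= dual_norm N w.
Proof.
move=> Ny; apply: ub_le_sup; last by exists y.
have [c c0 Nc] := mx_norm_le_is_norm.
exists (q%:R * `|w| * c^-1) => _ [z /= Nz <-].
rewrite (le_trans (ler_norm _))// (le_trans (abs_dot_le _ _))//.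
rewrite ler_wpM2l ?mulr_ge0//.
by rewrite -(ler_pM2l c0) divff ?gt_eqF// (le_trans (Nc z)).
Qed.

Lemma dot_le_dual_norm w y : dot w y <= dual_norm N w * N y.
Proof.
have [->|y0] := eqVneq y 0; first by rewrite is_norm0 mulr0 dot0r.
have Ny := is_norm_gt0 y0.
rewrite -ler_pdivrMr// mulrC -dotZr; apply: dot_le_dual_norm_ball.
by rewrite NZ ger0_norm ?invr_ge0 ?(ltW Ny)// mulVf ?gt_eqF.
Qed.

Lemma dual_norm_le w c :
  (forall y, N y <= 1 -> dot w y <= c) -> dual_norm N w <= c.
Proof.
move=> wc; apply: ge_sup; last by move=> _ [y /= Ny <-]; exact: wc.
by exists (dot w 0), 0; rewrite //= is_norm0.
Qed.

Lemma dual_norm_gt0 w : w != 0 -> 0 < dual_norm N w.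
Proof.
move=> w0; rewrite -(pmulr_lgt0 _ (is_norm_gt0 w0)).
exact: lt_le_trans (dot_gt0 w0) (dot_le_dual_norm w w).
Qed.

Lemma dual_norm_normalized w :
  w != 0 -> dual_norm N ((dual_norm N w)^-1 *: w) <= 1.
Proof.
move=> w0; apply: dual_norm_le => y Ny.
rewrite dotZl mulrC ler_pdivrMr ?dual_norm_gt0// mul1r.
exact: dot_le_dual_norm_ball.
Qed.

(** Points in the same cell of a fine enough grid are closer than [e], so a
    separated family has at most as many members as there are cells. *)
Lemma separated_size_bounded (B : set 'cV[R]_q) L e : 0 < e ->
  (forall y, B y -> forall i, `|y i 0| <= L) ->
  exists M, forall s : seq 'cV[R]_q, {in s, forall y, B y} ->
    pairwise (fun y z => e <= N (y - z)) s -> (size s <= M)%N.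
Proof.
move=> e0 BL; have [k Nk] := is_norm_le_mx_norm.
have [d d0 kd] : exists2 d, 0 < d & `|k| * d < e.
  have k1 : 0 < `|k| + 1 by rewrite ltr_wpDl.
  exists (e / (`|k| + 1)); first by rewrite divr_gt0.
  by rewrite mulrCA gtr_pMr// ltr_pdivrMr// mul1r ltrDl.
pose K := Num.truncn ((L + L) / d).
pose cell y : {ffun 'I_q -> 'I_K.+1} :=
  [ffun i => inord (Num.truncn ((y i 0 + L) / d))].
have L0 y i : B y -> 0 <= (y i 0 + L) / d.
  move=> /BL /(_ i); rewrite ler_norml => /andP[h _].
  by rewrite divr_ge0 ?(ltW d0)//; lra.
have cellK y i : B y -> (Num.truncn ((y i 0 + L) / d)%R < K.+1)%N.
  move=> By; rewrite ltnS le_truncn// ler_pM2r ?invr_gt0//.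
  by move: (BL _ By i); rewrite ler_norml => /andP[_ h]; lra.
have cell_close y z : B y -> B z -> cell y = cell z -> N (y - z) < e.
  move=> By Bz /ffunP yz; apply: le_lt_trans (Nk _) _.
  suff yzd : `|y - z| <= d.
    apply: le_lt_trans kd.
    by rewrite (le_trans (ler_wpM2r _ (ler_norm k)))// ler_wpM2l.
  apply: norm_le_entries => [|i j]; first exact: ltW.
  rewrite (ord1 j) !mxE; have := yz i; rewrite !ffunE => /(congr1 val) /=.
  rewrite !inordK ?cellK// => yzi.
  have /andP[] := truncn_itv (L0 _ i By).
  have /andP[] := truncn_itv (L0 _ i Bz).
  rewrite yzi !(ler_pdivlMr, ltr_pdivrMr)// => h1 h2 h3 h4.
  move: h2 h4; rewrite -natr1 mulrDl mul1r => h2 h4.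
  by rewrite ler_norml; apply/andP; split; lra.
exists #|{ffun 'I_q -> 'I_K.+1}| => s sB sep.
rewrite -(size_map cell) cardE uniq_leq_size//; last first.
  by move=> ? _; rewrite mem_enum.
elim: s sB sep => //= y s IH sB /andP[/allP ysep sep]; apply/andP; split.
  apply/mapP => -[z zs yz].
  have := ysep _ zs; rewrite leNgt cell_close//; apply: sB; rewrite inE ?eqxx//.
  by rewrite zs orbT.
by apply: IH => // z zs; apply: sB; rewrite inE zs orbT.
Qed.

End norms.

(** * Closed convex cones *)

Section cone_separation.
Context {R : realType} {q : nat} (C : set 'cV[R]_q).
Hypotheses (C_closed : closed C) (C_convex : segment_closed C).
Hypotheses (C_cone : cone C) (C0 : C 0).
Implicit Types (B : set 'cV[R]_q) (w y : 'cV[R]_q).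

Lemma coneD a b : C a -> C b -> C (a + b).
Proof.
move=> Ca Cb.
have -> : a + b = 2 *: (2^-1 *: a + (1 - 2^-1) *: b).
  by apply/colP => i; rewrite !mxE; field.
by apply: C_cone => //; apply: C_convex => //; lra.
Qed.

Lemma ge0_of_ray_gt0 (a b : R) : (forall t, 0 <= t -> 0 < t * a + b) -> 0 <= a.
Proof.
move=> ab; rewrite leNgt; apply/negP => a0.
have b0 : 0 < b by have := ab 0 (lexx _); rewrite mul0r add0r.
have := ab (b / - a); rewrite divr_ge0 ?oppr_ge0 ?(ltW b0) ?(ltW a0)//.
by move=> /(_ isT); rewrite invrN mulrN mulNr divfK ?lt_eqF// addNr ltxx.
Qed.

(** The separating functional is positive on all of [C + B]; scaling the
    summand from [C] by arbitrarily large factors shows that it belongs to the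
    dual cone. *)
Lemma cone_sep B : closed [set c + b | c in C & b in B] ->
  segment_closed [set c + b | c in C & b in B] -> B !=set0 ->
  (forall b, B b -> ~ C (- b)) ->
  exists w, [/\ w != 0, dual_cone C w & forall b, B b -> 0 < dot w b].
Proof.
move=> clCB cCB [b0 Bb0] CB0.
have [||w w0 wCB] := convex_closed_sep0 clCB cCB.
- by exists (0 + b0), 0 => //; exists b0.
- move=> [c Cc [b Bb /(canRL (addrK b))]]; rewrite sub0r => cb.
  by apply: (CB0 _ Bb); rewrite -cb.
exists w; split => // [c Cc|b Bb].
  apply: (@ge0_of_ray_gt0 _ (dot w b0)) => t t0.
  rewrite -dotZr -dotDr; apply: wCB; exists (t *: c); first exact: C_cone.
  by exists b0.
by apply: wCB; exists 0 => //; exists b; rewrite ?add0r.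
Qed.

(** A point outside of [C] is separated from it by an element of the dual
    cone. *)
Lemma bipolar y : (forall w, dual_cone C w -> 0 <= dot w y) -> C y.
Proof.
move=> Cy; apply: contrapT => nCy.
have [||||w [_ Cw /(_ (- y) erefl)]] := @cone_sep [set - y].
- by apply: closedD_compact => //; exact: compact_set1.
- move=> _ _ t [a Ca [_ -> <-]] [b Cb [_ -> <-]] t01.
  exists (t *: a + (1 - t) *: b); first exact: C_convex.
  by exists (- y) => //; apply/colP => i; rewrite !mxE; ring.
- by exists (- y).
- by move=> _ ->; rewrite opprK.
by rewrite dotNr oppr_gt0; move: (Cy w Cw); lra.
Qed.

End cone_separation.

(** * Solutions of the scalarized problems *)

Section scalarizations.
Context {R : realType} {n q : nat} (N : 'cV[R]_q -> R) (N_norm : is_norm N).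
Context (C : set 'cV[R]_q) (C_closed : closed C) (C_convex : segment_closed C)
  (C_cone : cone C) (C0 : C 0).
Context (X : set 'cV[R]_n) (G : 'cV[R]_n -> 'cV[R]_q) (F : set 'cV[R]_n).
Context (G_convex : cone_convex C X G) (G_continuous : {within F, continuous G})
  (F_sub : F `<=` X) (F_compact : compact F) (F_convex : segment_closed F)
  (F_nonempty : F !=set0).
Implicit Types (v w y z : 'cV[R]_q) (x : 'cV[R]_n).

Let image_compact : compact (G @` F).
Proof. exact: continuous_compact. Qed.

(** As this set is [G F + C - v], the norm minimization problem at [v] asks for
    its point nearest to the origin. *)
Definition excess v : set 'cV[R]_q :=
  [set z | exists x, P_feasible C F G v x z].

Lemma excessE v :
  excess v = [set c + b | c in C & b in [set y - v | y in G @` F]].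
Proof.
apply/seteqP; split=> [z [x [Cxz Fx]]|_ [c Cc [_ [_ [x Fx <-] <-] <-]]].
  exists (0 - (G x - z - v)) => //; exists (G x - v).
    by exists (G x) => //; exists x.
  by apply/colP => i; rewrite !mxE; ring.
exists x; split => //; rewrite /le_cone.
by rewrite [X in C X](_ : _ = c)//; apply/colP => i; rewrite !mxE; ring.
Qed.

Lemma excess_closed v : closed (excess v).
Proof.
rewrite excessE; apply: closedD_compact => //.
apply: continuous_compact => //; apply: continuous_subspaceT.
apply: (@lipschitz_continuous _ _ _ _ 1) => y z.
by rewrite mul1r opprB addrA subrK.
Qed.

Lemma excess_nonempty v : excess v !=set0.
Proof.
have [x Fx] := F_nonempty; exists (G x - v), x; split => //.
rewrite /le_cone [X in C X](_ : _ = 0)//.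
by apply/colP => i; rewrite !mxE; ring.
Qed.

(** The image of [F] need not be convex, but adding [C] repairs this, by
    [C]-convexity of [G]. *)
Lemma excess_convex v : segment_closed (excess v).
Proof.
move=> z1 z2 t [x1 [Cz1 F1]] [x2 [Cz2 F2]] t01.
exists (t *: x1 + (1 - t) *: x2); split; last exact: F_convex.
have Cx := G_convex (F_sub F1) (F_sub F2) t01.
have := coneD C_convex C_cone Cx (C_convex Cz1 Cz2 t01).
rewrite /le_cone; congr C; apply/colP => i; rewrite !mxE; ring.
Qed.

Lemma P_optimal_exists v : exists x z, P_optimal N C F G v x z.
Proof.
have [z [x xz] minz] := coercive_attains_min (is_norm_continuous N_norm)
  (is_norm_coercive N_norm) (@excess_closed v) (excess_nonempty v).
by exists x, z; split => // x' z' xz'; apply: minz; exists x'.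
Qed.

Let phi w := inf [set dot w (G x) | x in F].

Let image_bounded : exists2 m, 0 <= m & forall x, F x -> `|G x| <= m.
Proof.
have [M [_ GM]] := compact_bounded image_compact.
have [x Fx] := F_nonempty.
have Gm x' : F x' -> `|G x'| <= M + 1.
  by move=> Fx'; apply: GM; [rewrite ltrDl|exists x'].
by exists (M + 1) => //; apply: le_trans (Gm _ Fx).
Qed.

Let phi_has_lbound w : has_lbound [set dot w (G x) | x in F].
Proof.
have [m m0 Gm] := image_bounded.
exists (- (q%:R * `|w| * m)) => _ [x Fx <-].
rewrite lerNl (le_trans (ler_norm _))// normrN (le_trans (abs_dot_le _ _))//.
by rewrite ler_wpM2l ?mulr_ge0// Gm.
Qed.

Let D_objectiveE v w : D_objective F G v w = (phi w - dot w v)%:E.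
Proof.
rewrite /D_objective EFinB -ereal_inf_EFin ?image_comp//.
have [x Fx] := F_nonempty; by exists (dot w (G x)), x.
Qed.

(** As an infimum of linear functions with uniformly bounded coefficients, [phi]
    is Lipschitz. *)
Let phi_continuous : continuous phi.
Proof.
have [m m0 Gm] := image_bounded.
have phi_le w w' : phi w - q%:R * m * `|w - w'| <= phi w'.
  apply: lb_le_inf.
    by have [x Fx] := F_nonempty; exists (dot w' (G x)), x.
  move=> _ [x Fx <-].
  have : phi w <= dot w (G x) by apply: ge_inf => //; exists x.
  have := le_trans (ler_norm _) (abs_dot_le (w - w') (G x)).
  have : q%:R * `|w - w'| * `|G x| <= q%:R * `|w - w'| * m.
    by rewrite ler_wpM2l ?mulr_ge0// Gm.
  rewrite dotBl mulrAC; lra.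
apply: (@lipschitz_continuous _ _ _ _ (q%:R * m)) => w w'.
have := phi_le w w'; have := phi_le w' w; rewrite (distrC w') => h1 h2.
by rewrite ler_norml; apply/andP; split; lra.
Qed.

Lemma D_feasible0 : D_feasible N C 0.
Proof.
split; first by apply: dual_norm_le => // y _; rewrite dot0l.
by move=> y _; rewrite dot0l.
Qed.

(** Testing the dual norm on coordinate vectors bounds the entries of a feasible
    [w], and feasibility is a conjunction of non-strict linear inequalities. *)
Lemma D_feasible_compact : compact (D_feasible N C).
Proof.
have wy w i : D_feasible N C w -> `|w i 0| <= N (delta_mx i 0).
  move=> [w1 _]; rewrite -dot_delta dotC ler_norml lerNl -dotNr.
  have Nd : N (- delta_mx i 0) = N (delta_mx i 0) by rewrite is_normN.
  rewrite -{1}Nd.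
  have le y : dot w y <= N y.
    apply: (le_trans (dot_le_dual_norm N_norm w y)).
    by rewrite ler_piMl// is_norm_ge0.
  by rewrite !le.
apply: (@cV_bounded_closed_compact _ _ _ (\sum_i N (delta_mx i 0))).
  move=> w /wy wle i; apply: (le_trans (wle i)).
  rewrite (bigD1 i)//= lerDl sumr_ge0// => k _; exact: is_norm_ge0.
have -> : D_feasible N C = [set w | dual_norm N w <= 1] `&` dual_cone C by [].
apply: closedI.
  have -> : [set w | dual_norm N w <= 1] =
      \bigcap_(y in [set y | N y <= 1]) [set w | - 1 <= dot (- y) w].
    apply/seteqP; split=> w /=.
      move=> w1 y /= Ny; rewrite dotNl lerN2 dotC.
      exact: le_trans (dot_le_dual_norm_ball N_norm w Ny) w1.
    move=> h; apply: dual_norm_le => // y Ny.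
    by have := h y Ny; rewrite /= dotNl lerN2 dotC.
  by apply: closed_bigI => y _; exact: closed_halfspace.
have -> : dual_cone C = \bigcap_(y in C) [set w | 0 <= dot y w].
  by apply/seteqP; split=> w h y /h /=; rewrite dotC.
by apply: closed_bigI => y _; exact: closed_halfspace.
Qed.

Lemma D_optimal_exists v : exists w, D_optimal N C F G v w.
Proof.
have [|||w] := @compact_EVT_max _ _ (fun w => phi w - dot v w) (D_feasible N C).
- by exists 0; exact: D_feasible0.
- exact: D_feasible_compact.
- apply: continuous_subspaceT => w; apply: (@cvgB _ _ _ (nbhs w)).
    exact: phi_continuous.
  exact: dot_continuous.
rewrite inE => Dw maxw; exists w; split => // w' Dw'.
rewrite !D_objectiveE lee_fin !(dotC _ v); apply: maxw.
by rewrite inE.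
Qed.

(** Strong duality, in quantitative form: as no point of [excess v] lies in the
    ball of radius [e], a hyperplane separates [excess v] from that ball, and
    its normalized normal vector is feasible for the dual problem with value at
    least [e]. So the optimal value, attained by [w], is at least [e]; being an
    infimum over [F], it is at most the value at [x]. *)
Lemma cut_depth e v x z w : 0 < e ->
  P_optimal N C F G v x z -> D_optimal N C F G v w -> e < N z ->
  e <= dot w (G x) - dot w v.
Proof.
move=> e0 [[_ Fx] zmin] [_ wmax] ez.
(* The differences between [G F - v] and the ball; [C + B] misses the origin
   exactly when [excess v] misses the ball. *)
pose B := [set b + u | b in [set y - v | y in G @` F]
                     & u in [set u | N u <= e]].
have CB : [set c + b | c in C & b in B] =
    [set a + u | a in excess v & u in [set u | N u <= e]].
  rewrite excessE; apply/seteqP; split.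
    move=> _ [c Cc [_ [b Bb [u Nu <-]] <-]].
    by exists (c + b); [exists c => //; exists b|exists u; rewrite ?addrA].
  move=> _ [_ [c Cc [b Bb <-]] [u Nu <-]].
  by exists c => //; exists (b + u); rewrite ?addrA//; exists b => //; exists u.
have N0 : N 0 <= e by rewrite is_norm0// ltW.
have BG x' u : F x' -> N u <= e -> B (G x' - v + u).
  move=> Fx' Nu; exists (G x' - v); last by exists u.
  by exists (G x') => //; exists x'.
have [||||w0 [w00 Cw0 Bw0]] := @cone_sep _ _ _ C_cone C0 B.
- rewrite CB; apply: closedD_compact; first exact: excess_closed.
  exact: is_norm_ball_compact.
- rewrite CB => _ _ t [a1 A1 [u1 /= U1 <-]] [a2 A2 [u2 /= U2 <-]] t01.
  exists (t *: a1 + (1 - t) *: a2); first exact: excess_convex.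
  exists (t *: u1 + (1 - t) *: u2) => /=.
    apply: (le_trans (norm_triangle N_norm _ _)).
    rewrite !(norm_homog N_norm); move/andP: t01 => [t0 t1].
    rewrite !ger0_norm ?subr_ge0//.
    have := ler_wpM2l t0 U1.
    have : (1 - t) * N u2 <= (1 - t) * e by rewrite ler_wpM2l// subr_ge0.
    lra.
  by apply/colP => i; rewrite !mxE; ring.
- by exists (G x - v + 0); exact: BG.
- move=> _ [_ [_ [x' Fx' <-] <-] [u /= Nu <-]] Cxu.
  have : N z <= N (- u).
    apply: (zmin x'); split => //; rewrite /le_cone.
    by move: Cxu; congr C; apply/colP => i; rewrite !mxE; ring.
  by rewrite is_normN// => /le_trans /(_ Nu); rewrite leNgt ez.
pose d := dual_norm N w0.
have d0 : 0 < d by exact: dual_norm_gt0.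
have eG x' : F x' -> e <= d^-1 * dot w0 (G x' - v).
  move=> Fx'; rewrite mulrC ler_pdivlMr// mulrC -ler_pdivlMr//.
  apply: dual_norm_le => // y Ny; rewrite ler_pdivlMr//.
  (* Testing the separation at [- (e *: y)], for all [y] of the unit ball,
     recovers the dual norm of [w0]. *)
  have := Bw0 _ (BG x' (- (e *: y)) Fx' _).
  rewrite is_normN// (norm_homog N_norm) gtr0_norm// (ler_piMr (ltW e0) Ny).
  move=> /(_ isT).
  by rewrite dotDr dotNr dotZr; lra.
have Dw0 : D_feasible N C (d^-1 *: w0).
  split; first exact: dual_norm_normalized.
  by move=> y Cy; rewrite dotZl mulr_ge0 ?invr_ge0 ?(ltW d0) ?Cw0.
have := wmax _ Dw0; rewrite !D_objectiveE lee_fin => le_w.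
have : phi w <= dot w (G x) by apply: ge_inf => //; exists x.
suff : e + dot (d^-1 *: w0) v <= phi (d^-1 *: w0) by lra.
apply: lb_le_inf; first by exists (dot (d^-1 *: w0) (G x)), x.
by move=> _ [x' /eG Fx' <-]; move: Fx'; rewrite dotBr !dotZl; lra.
Qed.

(** Since the normal [w] of the cut has dual norm at most 1, the depth of the
    cut is a lower bound on the distance from [v] to the half-space. *)
Lemma cut_far e v x z w y : 0 < e ->
  P_optimal N C F G v x z -> D_optimal N C F G v w -> e < N z ->
  halfspace w (G x) y -> e <= N (y - v).
Proof.
move=> e0 Pz Dw ez xy.
have wyv := dot_le_dual_norm N_norm w (y - v).
have : dual_norm N w * N (y - v) <= N (y - v).
  by rewrite ler_piMl ?is_norm_ge0//; case: Dw => -[].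
have := cut_depth e0 Pz Dw ez.
by move: xy wyv; rewrite /halfspace/= dotBr; lra.
Qed.

End scalarizations.

(** * Polyhedra and their vertices *)

Section polyhedra.
Context {R : realType} {q : nat}.
Implicit Types (s : seq ('cV[R]_q * R)) (P S : set 'cV[R]_q) (v w y : 'cV[R]_q).

Definition solutions s : set 'cV[R]_q :=
  [set y | forall h, h \in s -> h.2 <= dot h.1 y].

Definition finite_halfspaces P := exists s, P = solutions s.

Lemma finite_halfspacesI P S : finite_halfspaces P -> finite_halfspaces S ->
  finite_halfspaces (P `&` S).
Proof.
move=> [s ->] [t ->]; exists (s ++ t); apply/seteqP; split.
  by move=> y [ys yt] h; rewrite mem_cat => /orP[/ys|/yt].
by move=> y yst; split=> h hs; apply: yst; rewrite mem_cat hs ?orbT.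
Qed.

Lemma finite_halfspaces_ge w c : finite_halfspaces [set y | c <= dot w y].
Proof.
exists [:: (w, c)]; apply/seteqP; split=> [y wy h|y wy].
  by rewrite inE => /eqP ->.
by apply: (wy (w, c)); rewrite inE.
Qed.

Lemma finite_halfspaces_le w c : finite_halfspaces [set y | dot w y <= c].
Proof.
have := finite_halfspaces_ge (- w) (- c); congr finite_halfspaces.
by apply/seteqP; split=> y /=; rewrite dotNl lerN2.
Qed.

Lemma finite_halfspaces_bigcap (J : nat) (H : 'I_J -> set 'cV[R]_q) :
  (forall j, finite_halfspaces (H j)) ->
  finite_halfspaces (\bigcap_(j in [set: 'I_J]) H j).
Proof.
move=> /choice[s Hs]; exists (flatten [seq s j | j <- enum 'I_J]).
apply/seteqP; split=> y yH.
  by move=> h /flatten_mapP[j _]; have := yH j I; rewrite Hs; exact.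
move=> j _; rewrite Hs => h hj; apply: yH; apply/flatten_mapP.
by exists j; rewrite ?mem_enum.
Qed.

Lemma step_within_slack s v d : exists2 t, 0 < t &
  forall h, h \in s -> h.2 < dot h.1 v -> t * `|dot h.1 d| <= dot h.1 v - h.2.
Proof.
elim: s => [|h s [t t0 ts]]; first by exists 1.
have [hv|vh] := ltP h.2 (dot h.1 v); last first.
  exists t => // g; rewrite inE => /predU1P[->|/ts//].
  by rewrite ltNge vh.
have c0 : 0 < `|dot h.1 d| + 1 by rewrite ltr_wpDl.
pose u := (dot h.1 v - h.2) / (`|dot h.1 d| + 1).
have u0 : 0 < u by rewrite divr_gt0// subr_gt0.
exists (Num.min t u); first by rewrite lt_min t0.
move=> g; rewrite inE => /predU1P[->|gs] gv; last first.
  by apply: le_trans (ts _ gs gv); rewrite ler_wpM2r// ge_min lexx.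
apply: (@le_trans _ _ (u * `|dot h.1 d|)).
  by rewrite ler_wpM2r// ge_min lexx orbT.
by rewrite /u mulrAC ler_pdivrMr// ler_wpM2l ?subr_ge0 ?ltW// ltrDl.
Qed.

(** A vertex is determined by the constraints that are tight at it: if two
    points have the same tight constraints, a short step from one of them along
    their difference, forwards or backwards, violates no constraint. *)
Lemma vertex_tight_inj s v w : vertices (solutions s) v -> solutions s w ->
  {in s, forall h, (dot h.1 v == h.2) = (dot h.1 w == h.2)} -> v = w.
Proof.
move=> [sv ext] sw tight; pose d := w - v.
have [t t0 ts] := step_within_slack s v d.
have step e : `|e| = t -> solutions s (v + e *: d).
  move=> et h hs; rewrite dotDr dotZr.
  have := sv _ hs; rewrite le_eqVlt => /predU1P[hv|hv].
    have hw : dot h.1 w == h.2 by rewrite -tight// hv.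
    by rewrite dotBr (eqP hw) -hv subrr mulr0 addr0.
  have := ts _ hs hv; rewrite -et -normrM ler_norml => /andP[? _].
  lra.
have vt : v + t *: d = v + (- t) *: d.
  apply: (ext _ _ 2^-1 (step _ _) (step _ _)).
  - exact: gtr0_norm.
  - by rewrite normrN gtr0_norm.
  - by rewrite invr_gt0 invf_lt1 ?ltr0n ?ltr1n.
  by apply/colP => i; rewrite !mxE; field.
move/addrI/eqP: vt; rewrite scaleNr -subr_eq0 opprK -mulr2n -scaler_nat scalerA.
rewrite scaler_eq0 mulf_eq0 pnatr_eq0/= (gt_eqF t0)/= subr_eq0 => /eqP.
exact: esym.
Qed.

Lemma finite_vertices P : finite_halfspaces P -> finite_set (vertices P).
Proof.
move=> [s ->].
pose tight v := map_tuple (fun h => dot h.1 v == h.2) (in_tuple s).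
(* A left inverse of [tight] on the vertices, so that they are covered by the
   image of a finite type. *)
pose pick b := xget 0 [set v | vertices (solutions s) v /\ tight v = b].
apply: (@sub_finite_set _ _ (range pick)); last first.
  exact/finite_image/finite_finset.
move=> v vv; exists (tight v) => //; apply/esym.
pose same := [set u | vertices (solutions s) u /\ tight u = tight v].
have [vp tp] : same (pick (tight v)) by apply: (@xgetPex _ 0 same); exists v.
apply: (vertex_tight_inj vv (proj1 vp)) => h hs.
by move: tp => /(congr1 val) /= /eq_in_map/(_ h hs) ->.
Qed.

End polyhedra.

(** * Boundedness of the truncated outer approximation *)

Section generators.
Context {R : realType} {q J : nat} (C : set 'cV[R]_q) (W : 'I_J -> 'cV[R]_q).
Hypotheses (C_closed : closed C) (C_convex : segment_closed C)
  (C_cone : cone C) (C0 : C 0) (C_pointed : pointed_cone C)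
  (W_gen : dual_cone C = conv_cone W).

Lemma generator_dual j : dual_cone C (W j).
Proof.
rewrite W_gen; exists (fun i => (i == j)%:R); split=> [i|]; first exact: ler0n.
rewrite (bigD1 j)//= eqxx scale1r big1 ?addr0// => i /negbTE ->.
by rewrite scale0r.
Qed.

(** Nonnegativity passes from the generators to their nonnegative combinations,
    which make up the dual cone, so the bipolar theorem applies. *)
Lemma cone_of_generators y : (forall j, 0 <= dot (W j) y) -> C y.
Proof.
move=> Wy; apply: bipolar => // w; rewrite W_gen => -[l [l0 ->]].
by rewrite dot_suml sumr_ge0// => j _; rewrite dotZl mulr_ge0.
Qed.

(** Otherwise [C] would contain the line through the origin and [y]. *)
Lemma generators_span y : (forall j, dot (W j) y = 0) -> y = 0.
Proof.
move=> Wy; apply/eqP/negPn/negP => y0; apply: C_pointed.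
exists 0, y; split=> // t.
by apply: cone_of_generators => j; rewrite add0r dotZr Wy mulr0.
Qed.

(** Generators are nonnegative on [C], so if their sum vanished, each of them
    would vanish on [C]; but they have no common zero other than the origin. *)
Lemma sum_generators_neq0 : [set 0] `<` C -> \sum_j W j != 0.
Proof.
move=> [_ /existsNP[y /not_implyP[Cy /eqP y0]]]; apply/eqP => W0.
apply/negP: y0; rewrite negbK; apply/eqP/generators_span.
have Wy0 j : 0 <= dot (W j) y by exact: generator_dual.
have := dot_suml W y; rewrite W0 dot0l => /esym/eqP.
by rewrite psumr_eq0// => /allP h j; apply/eqP/h; rewrite mem_index_enum.
Qed.

(** The generators span the whole space, so a point is a linear image of the
    values that they take at it. *)
Lemma bounded_of_generators k : exists L, forall y,
  (forall j, `|dot (W j) y| <= k) -> forall i, `|y i 0| <= L.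
Proof.
pose A : 'M[R]_(J, q) := \matrix_(j, i) W j i 0.
have AE y j : (A *m y) j 0 = dot (W j) y.
  by rewrite dotE mxE; apply: eq_bigr => i _; rewrite mxE.
have : row_free A^T.
  rewrite -kermx_eq0; apply/eqP/row_matrixP => i; rewrite row0.
  apply: trmx_inj; rewrite trmx0; apply: generators_span => j.
  have : row i (kermx A^T) *m A^T = 0 by rewrite -row_mul mulmx_ker row0.
  move=> /(congr1 trmx); rewrite trmx_mul trmxK trmx0 -AE => ->.
  by rewrite mxE.
move=> /row_freeP[B AB]; exists (\sum_i \sum_j `|B j i| * k) => y yk i.
have -> : y = B^T *m (A *m y).
  by rewrite mulmxA -[A]trmxK -trmx_mul AB trmx1 mul1mx.
have k0 (j : 'I_J) : 0 <= k by exact: le_trans (yk j).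
rewrite mxE (le_trans (ler_norm_sum _ _ _))// (bigD1 i)//=.
rewrite ler_wpDr//.
  by apply: sumr_ge0 => a _; apply: sumr_ge0 => j _; rewrite mulr_ge0// (k0 j).
by apply: ler_sum => j _; rewrite mxE AE normrM ler_wpM2l.
Qed.

(** Below the hyperplane the sum of the generators is bounded above, and each
    of its summands is bounded below. *)
Lemma outer_approximation_bounded (N : 'cV[R]_q -> R) n
    (G : 'cV[R]_n -> 'cV[R]_q) (x0 : 'I_J -> 'cV[R]_n) alpha beta :
  is_norm N -> [set 0] `<` C ->
  exists L, forall y,
    (P0_out G W x0 `&` bounding_halfspace N W alpha beta) y ->
    forall i, `|y i 0| <= L.
Proof.
move=> N_norm C_neq0.
pose l j := dot (W j) (G (x0 j)).
pose d := dual_norm N (\sum_j W j).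
have d0 : 0 < d by apply: dual_norm_gt0 => //; exact: sum_generators_neq0.
pose u := d * (beta + alpha).
have [L WL] := bounded_of_generators (`|u| + \sum_j `|l j|).
exists L => y [Py Sy]; apply: WL => j.
have lW i : l i <= dot (W i) y by exact: (Py i).
have : \sum_i dot (W i) y <= u.
  rewrite -dot_suml; move: Sy; rewrite /bounding_halfspace/= /wbar dotZl mulrC.
  by rewrite ler_pdivrMr// mulrC.
rewrite (bigD1 j)//= (bigD1 j (P := xpredT))//=.
have : \sum_(i < J | i != j) - `|l i| <= \sum_(i < J | i != j) dot (W i) y.
  apply: ler_sum => i _; apply: le_trans (lW i).
  by rewrite lerNl -normrN ler_norm.
rewrite sumrN; set a := bigop _ _ _; set b := bigop _ _ _ => ab bu.
have a0 : 0 <= a by exact: sumr_ge0.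
have := lW j; have := ler_norm (- l j); rewrite normrN => ? ?.
have := ler_norm u; have := normr_ge0 u; have := normr_ge0 (l j) => ? ? ?.
by rewrite ler_norml; apply/andP; split; lra.
Qed.

End generators.

(** * Termination *)

(** Well-founded induction for loops that remove one element at a time. *)
Lemma finite_set_removal_ind (T : eqType) (Q : set T -> Prop) :
  (forall A, (forall x, A x -> Q (A `\ x)) -> Q A) ->
  forall A, finite_set A -> Q A.
Proof.
move=> ind A /finite_seqP[s As].
have {As} : A `<=` [set` s] by rewrite As.
elim: (size s).+1 {-2}s (leqnn (size s).+1) A => // m IH {}s sm A As.
apply: ind => x Ax; apply: (IH [seq y <- s | y != x]).
  rewrite size_filter -ltnS (leq_trans _ sm)// ltnS -(count_predC (pred1 x) s).
  by rewrite -[X in (X < _)%N]add0n ltn_add2r -has_count has_pred1; exact: As.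
by move=> y [/As /= ys /eqP yx]; rewrite /= mem_filter yx.
Qed.

Section termination.
Context {R : realType} {n q : nat} (N : 'cV[R]_q -> R) (C : set 'cV[R]_q).
Context (F : set 'cV[R]_n) (G : 'cV[R]_n -> 'cV[R]_q) (eps : R).
Context (S P0 : set 'cV[R]_q).
Hypotheses (P_solvable : forall v, exists x z, P_optimal N C F G v x z)
  (D_solvable : forall v, exists w, D_optimal N C F G v w).
Hypothesis far : forall v x z w y, P_optimal N C F G v x z ->
  D_optimal N C F G v w -> eps < N z -> halfspace w (G x) y -> eps <= N (y - v).
Hypothesis S_halfspaces : finite_halfspaces S.
Context (M : nat).
Hypothesis separated_size : forall vs : seq 'cV[R]_q,
  {in vs, forall y, (P0 `&` S) y} ->
  pairwise (fun y z => eps <= N (y - z)) vs -> (size vs <= M)%N.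

Implicit Types (s vs : seq 'cV[R]_q) (T K P : set 'cV[R]_q) (Xs : set 'cV[R]_n).

(** The invariant of the outer approximation [P], where [vs] lists the points at
    which the main loop has made cuts. The cuts made during initialization are
    left out: there is at most one for each of the finitely many initial
    vertices. *)
Record cut_at vs P : Prop := CutAt {
  cut_at_halfspaces : finite_halfspaces P ;
  cut_at_sub : P `<=` P0 ;
  cut_at_far : forall y u, P y -> u \in vs -> eps <= N (y - u) }.

Lemma cut_at_cut vs P v x z w : cut_at vs P ->
  P_optimal N C F G v x z -> D_optimal N C F G v w -> eps < N z ->
  cut_at (v :: vs) (P `&` halfspace w (G x)).
Proof.
move=> [Pfin PP0 Pfar] Pz Dw ez; split.
- by apply: finite_halfspacesI => //; exact: finite_halfspaces_ge.
- by move=> y [/PP0].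
- move=> y u [Py wy]; rewrite inE => /predU1P[->|uvs]; last exact: Pfar.
  exact: far Dw ez wy.
Qed.

(** The cuts already made form a separated family, so [m] bounds the number of
    cuts still to come; between two cuts the finite set of pending vertices
    shrinks with every step. *)
Lemma terminates_main m vs P : {in vs, forall y, (P0 `&` S) y} ->
  pairwise (fun y z => eps <= N (y - z)) vs -> (M <= size vs + m)%N ->
  cut_at vs P -> forall T, finite_set T -> T `<=` P `&` S ->
  forall k K Xs, terminates N C F G eps S (Main k T K Xs P).
Proof.
elim/ltn_ind: m vs P => m IHm vs P vsB sep Mm cutP.
apply: finite_set_removal_ind => T IHT TPS k K Xs.
have cut v x z w : T v -> P_optimal N C F G v x z -> D_optimal N C F G v w ->
    eps < N z -> terminates N C F G eps S
      (Main k.+1 (vertices (P `&` halfspace w (G x) `&` S)) (v |` K) Xs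
        (P `&` halfspace w (G x))).
  move=> Tv Pz Dw ez; have [Pv Sv] := TPS _ Tv.
  have vB : {in v :: vs, forall y, (P0 `&` S) y}.
    move=> y; rewrite inE => /predU1P[->|]; last exact: vsB.
    by split=> //; exact: cut_at_sub cutP _ Pv.
  have vsep : pairwise (fun y z => eps <= N (y - z)) (v :: vs).
    by rewrite /= sep andbT; apply/allP => u; exact: (cut_at_far cutP Pv).
  have m0 : (0 < m)%N.
    have := leq_trans (separated_size vB vsep) Mm.
    by rewrite /= -[X in (X < _)%N]addn0 ltn_add2l.
  have cutvP := cut_at_cut cutP Pz Dw ez.
  apply: (IHm m.-1 _ (v :: vs)) => //.
  - by rewrite prednK.
  - by rewrite /= addSnnS prednK.
  - apply: finite_vertices; apply: finite_halfspacesI S_halfspaces.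
    exact: cut_at_halfspaces cutvP.
  - by move=> y [].
have [T0|/set0P[v Tv]] := eqVneq T set0.
  rewrite T0 in IHT TPS cut *.
  apply: terminates_step; first exact: step_main_end.
  move=> nx' st; inversion st; subst => //; exact: terminates_done.
have TvPS : T `\ v `<=` P `&` S by move=> y [/TPS].
have [x [z Pz]] := P_solvable v; have [w Dw] := D_solvable v.
have [nx stepnx] : exists nx, step N C F G eps S (Main k T K Xs P) nx.
  have [Kv|Kv] := pselect (K v); first by eexists; exact: step_main_skip Tv Kv.
  have [ez|ez] := ltP eps (N z).
    by eexists; exact: step_main_cut Tv Kv Pz Dw ez.
  by eexists; exact: step_main_add Tv Kv Pz Dw ez.
apply: terminates_step stepnx _ => nx' st; inversion st; subst.
- by apply: IHT => // y [/TPS].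
- by apply: cut; eassumption.
- by apply: IHT => // y [/TPS].
- by case: Tv.
Qed.

Lemma terminates_init P : cut_at [::] P ->
  forall T, finite_set T ->
  forall K Xs, terminates N C F G eps S (Init T K Xs P).
Proof.
move=> cutP T Tfin; move: T Tfin P cutP.
apply: finite_set_removal_ind => T IHT P cutP K Xs.
have [T0|/set0P[v Tv]] := eqVneq T set0.
  rewrite T0; apply: terminates_step; first exact: step_init_end.
  move=> nx' st; inversion st; subst => //.
  apply: (@terminates_main M [::]) => //.
    apply: finite_vertices; apply: finite_halfspacesI S_halfspaces.
    exact: cut_at_halfspaces cutP.
  by move=> y [].
have [x [z Pz]] := P_solvable v; have [w Dw] := D_solvable v.
have [nx stepnx] : exists nx, step N C F G eps S (Init T K Xs P) nx.
  have [ez|ez] := ltP eps (N z).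
    by eexists; exact: step_init_cut Tv Pz Dw ez.
  by eexists; exact: step_init_add Tv Pz Dw ez.
apply: terminates_step stepnx _ => nx' st; inversion st; subst.
- apply: IHT => //; split=> //.
    apply: finite_halfspacesI (finite_halfspaces_ge _ _).
    exact: cut_at_halfspaces cutP.
  by move=> y [/(cut_at_sub cutP)].
- exact: IHT.
- by case: Tv.
Qed.

End termination.

Unset Implicit Arguments.

Theorem theorem7p3 (R : realType) (n q : nat) (n_gt0 : (0 < n)%N)
  (q_gt0 : (0 < q)%N)
  (N : 'cV[R]_q -> R) (N_norm : is_norm N)
  (C : set 'cV[R]_q)
  (C_polyhedral : polyhedron C) (C_closed : closed C)
  (C_convex : convex_set C) (C_cone : cone C)
  (C_solid : solid C) (C_pointed : pointed_cone C)
  (C_nontrivial : nontrivial_cone C)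
  (X : set 'cV[R]_n) (X_convex : convex_set X)
  (G : 'cV[R]_n -> 'cV[R]_q)
  (G_convex : cone_convex C X G) (G_continuous : {within X, continuous G})
  (F : set 'cV[R]_n) (F_sub : F `<=` X) (F_compact : compact F)
  (F_convex : convex_set F) (F_interior : interior F !=set0)
  (eps : R) (eps_gt0 : 0 < eps)
  (J : nat) (W : 'I_J -> 'cV[R]_q) (W_neq0 : forall j, W j != 0)
  (W_gen : dual_cone C = conv_cone W)
  (x0 : 'I_J -> 'cV[R]_n) (x0_opt : forall j, WS_optimal F G (W j) (x0 j))
  (alpha beta : R)
  (beta_ge : (ereal_sup [set (dot (wbar N W) (G x))%:E | x in F]
              <= beta%:E)%E)
  (alpha_gt : (ereal_sup [set (Num.max (dot (wbar N W) v - beta) 0)%:E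
                         | v in vertices (P0_out G W x0)]
               + hausdorff_dist N (P0_out G W x0) (upper_image C F G)
               < alpha%:E)%E) :
  terminates N C F G eps (bounding_halfspace N W alpha beta)
    (initial_state G W x0).
Proof.
have C_seg := convex_setP C_convex.
have C0 : C 0 by case: C_nontrivial => -[+ _] _; exact.
have F_seg := convex_setP F_convex.
have F_nonempty : F !=set0.
  by case: F_interior => x /interior_subset; exists x.
have G_contF : {within F, continuous G}.
  exact: continuous_subspaceW G_continuous.
have [L PSL] := outer_approximation_bounded C_closed C_seg C_cone C0 C_pointed
  W_gen G x0 alpha beta N_norm (proj1 C_nontrivial).
have [M sepM] := separated_size_bounded N_norm eps_gt0 PSL.
have P0_halfspaces : finite_halfspaces (P0_out G W x0).
  by apply: finite_halfspaces_bigcap => j; exact: finite_halfspaces_ge.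
apply: (@terminates_init _ _ _ N C F G eps _ (P0_out G W x0) _ _ _ _ M).
- by move=> v; apply: P_optimal_exists.
- by move=> v; exact: D_optimal_exists.
- move=> v x z w y.
  by apply: (cut_far N_norm C_closed C_seg C_cone C0 G_convex).
- exact: finite_halfspaces_le.
- exact: sepM.
- by split.
- exact: finite_vertices.
Qed.
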